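(* Let $(X,\langle\cdot|\cdot\rangle)$ be an infinite-dimensional complex Hilbert space and $A:D(A)\to X$ a densely-defined, linear and self-adjoint operator with a purely discrete spectrum $\sigma(A)$. Let $(e_k)_{k\in\mathbb{N}^*}$ be a Hilbert basis of $X$ consisting of eigenvectors of $A$, with corresponding eigenvalues $(\lambda_k)_{k\in\mathbb{N}^*}$, so that $\sigma(A)=\{\lambda_k:k\in\mathbb{N}^*\}$. Let $*$ be the convolution on $X$ associated to this basis, i.e. $$\xi*\eta=\sum_{k\in\mathbb{N}^*}\langle e_k|\xi\rangle\langle e_k|\eta\rangle\,e_k,\qquad \xi,\eta\in X .$$ Let $C\in X$ and $c\in\mathbb{R}$, and let $c-C*\cdot$ denote the operator $\xi\mapsto c\,\xi-C*\xi$ on $X$. Then: (i) $c-C*\cdot$ is a bounded operator. (ii) $c-C*\cdot$ is self-adjoint if and only if $\langle e_k|C\rangle$ is real for every $k\in\mathbb{N}^*$; and, if it is self-adjoint, it is positive if and only if $\langle e_k|C\rangle\leqslant c$ for every $k\in\mathbb{N}^*$. (iii) If in addition $\langle e_k|C\rangle=\langle e_l|C\rangle$ for all $k,l\in\mathbb{N}^*$ such that $\lambda_k=\lambda_l$, then $$c-C*\cdot=(c-f)(A),$$ where the bounded function $f:\sigma(A)\to\mathbb{C}$ is defined by $f(\lambda_k):=\langle e_k|C\rangle$, $k\in\mathbb{N}^*$.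
   Context: $\mathbb{N}^*=\{1,2,\dots\}$. The inner product is conjugate-linear in the first and linear in the second argument. ''Purely discrete spectrum'' means that $\sigma(A)$ is discrete and contains only eigenvalues of finite multiplicity. A self-adjoint bounded operator $T$ is positive if $\langle\xi|T\xi\rangle\geqslant0$ for all $\xi\in X$. For a bounded function $h:\sigma(A)\to\mathbb{C}$, $h(A)$ is given by the functional calculus: $h(A)\xi=\sum_{k=1}^\infty h(\lambda_k)\langle e_k|\xi\rangle e_k$. *)

(* Defs.v *)
From HB Require Import structures.
From mathcomp Require Import all_boot all_order all_algebra.
From mathcomp Require Import complex.
From mathcomp Require Import all_classical all_reals all_analysis.

Set Implicit Arguments.
Unset Strict Implicit.
Unset Printing Implicit Defensive.

Import Order.TTheory GRing.Theory Num.Theory.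
Import numFieldNormedType.Exports.

Local Open Scope classical_set_scope.
Local Open Scope ring_scope.
Local Open Scope complex_scope.

Section HilbertSpace.
Variables (R : realType) (X : completeNormedModType R[i]).

(* The forms of type {dot X for Num.conj} are linear in their first argument;
   the inner product <x|y> is conjugate-linear in x and linear in y. *)
Definition inner (dot : {dot X for Num.conj}) (x y : X) : R[i] := dot y x.

(* The norm of X (with values in R[i]) is the one induced by the inner product.
   As X is complete, this makes X a complex Hilbert space. *)
Definition hilbert_norm (dot : {dot X for Num.conj}) : Prop :=
  forall x : X, `|x| ^+ 2 = inner dot x x.

Definition finite_dimensional (V : set X) : Prop :=
  exists (n : nat) (v : 'I_n -> X),
    forall x, V x -> exists a : 'I_n -> R[i], x = \sum_(i < n) a i *: v i.

(* An operator D(A) -> X is a pair of D : set X and A : X -> X; the values of A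
   outside D are irrelevant, and nothing below depends on them. *)
Definition linear_operator (D : set X) (A : X -> X) : Prop :=
  D 0 /\
  forall (a : R[i]) (x y : X), D x -> D y ->
    D (a *: x + y) /\ A (a *: x + y) = a *: A x + A y.

Definition bounded_operator (T : X -> X) : Prop :=
  linear T /\ exists M : R, forall x, `|T x| <= M%:C * `|x|.

(* y belongs to the domain of the adjoint of A, and the adjoint maps y to z.  This
   is the graph of a function when D is dense. *)
Definition adjoint_graph (dot : {dot X for Num.conj})
    (D : set X) (A : X -> X) (y z : X) : Prop :=
  forall x, D x -> inner dot y (A x) = inner dot z x.

Definition self_adjoint (dot : {dot X for Num.conj})
    (D : set X) (A : X -> X) : Prop :=
  forall y z, adjoint_graph dot D A y z <-> (D y /\ A y = z).

Definition positive_operator (dot : {dot X for Num.conj}) (T : X -> X) : Prop :=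
  forall x, 0 <= inner dot x (T x).

(* The topology of the complex plane is carried by the alias R[i]^o of R[i]. *)
Definition resolvent_set (D : set X) (A : X -> X) : set R[i]^o :=
  [set z | exists B : X -> X,
    [/\ bounded_operator B,
        forall y, D (B y) /\ A (B y) - z *: B y = y &
        forall x, D x -> B (A x - z *: x) = x]].

Definition spectrum (D : set X) (A : X -> X) : set R[i]^o :=
  ~` resolvent_set D A.

Definition eigenvector (D : set X) (A : X -> X) (z : R[i]) (x : X) : Prop :=
  [/\ D x, x != 0 & A x = z *: x].

Definition operator_eigenvalue (D : set X) (A : X -> X) (z : R[i]) : Prop :=
  exists x, eigenvector D A z x.

Definition operator_eigenspace (D : set X) (A : X -> X) (z : R[i]) : set X :=
  [set x | D x /\ A x = z *: x].

Definition purely_discrete_spectrum (D : set X) (A : X -> X) : Prop :=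
  forall z, spectrum D A z ->
    [/\ isolated (spectrum D A) z, operator_eigenvalue D A z &
        finite_dimensional (operator_eigenspace D A z)].

(* Sequences are indexed from 0: e k stands for the basis vector of index k + 1. *)
Definition hilbert_basis (dot : {dot X for Num.conj}) (e : nat -> X) : Prop :=
  (forall k l, inner dot (e k) (e l) = (k == l)%:R) /\
  dense [set x | exists (n : nat) (a : nat -> R[i]),
                   x = \sum_(k < n) a k *: e k].

Definition convolution (dot : {dot X for Num.conj}) (e : nat -> X)
    (x y : X) : X :=
  limn (series (fun k => (inner dot (e k) x * inner dot (e k) y) *: e k)).

(* h(A), for A diagonal in the basis e with eigenvalues lambda; only the values
   of h on the spectrum of A matter. *)
Definition functional_calculus (dot : {dot X for Num.conj}) (e : nat -> X)
    (lambda : nat -> R[i]) (h : R[i] -> R[i]) (x : X) : X :=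
  limn (series (fun k => (h (lambda k) * inner dot (e k) x) *: e k)).

Definition sub_convolution (dot : {dot X for Num.conj}) (e : nat -> X)
    (c : R) (C x : X) : X :=
  c%:C *: x - convolution dot e C x.

End HilbertSpace.

(* Main.v *)
(* The operator [c - C * .] is diagonal in the basis [e], with bounded entries
   [c - <e_k|C>].  For any bounded multiplier m, the operator T_m with
   <e_k|T_m x> = m_k <e_k|x> exists: the partial sums of the expansion of x are
   best approximations, hence converge to x by density of the span, and by
   orthonormality those of T_m x are Cauchy because they are dominated by them.
   Vectors are determined by their coordinates, so every identity between such
   operators is checked coordinatewise.  The spectrum consists of eigenvalues,
   and an eigenvector x for z has some <e_k|x> <> 0; symmetry of A gives
   lambda_k <e_k|x> = z <e_k|x>, hence z = lambda_k. *)
Require Import Defs.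
From HB Require Import structures.
From mathcomp Require Import all_boot all_order all_algebra.
From mathcomp Require Import complex.
From mathcomp Require Import all_classical all_reals all_analysis.

Set Implicit Arguments.
Unset Strict Implicit.
Unset Printing Implicit Defensive.

Import Order.TTheory GRing.Theory Num.Theory.
Import numFieldNormedType.Exports.

Local Open Scope classical_set_scope.
Local Open Scope ring_scope.
Local Open Scope complex_scope.

(** * Inner product: Pythagoras, Cauchy-Schwarz, continuity *)

Section InnerProduct.
Variables (R : realType) (X : completeNormedModType R[i]).
Variables (dot : {dot X for Num.conj}).

Lemma innerC (x y : X) : inner dot x y = Num.conj (inner dot y x).
Proof. by rewrite /inner hermC expr0 mul1r. Qed.

Lemma innerDr (x y z : X) : inner dot x (y + z) = inner dot x y + inner dot x z.
Proof. by rewrite /inner linearDl. Qed.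

Lemma innerBr (x y z : X) : inner dot x (y - z) = inner dot x y - inner dot x z.
Proof. by rewrite /inner linearBl. Qed.

Lemma innerZr (a : R[i]) (x y : X) : inner dot x (a *: y) = a * inner dot x y.
Proof. by rewrite /inner linearZl_LR. Qed.

Lemma inner0r (x : X) : inner dot x 0 = 0.
Proof. by rewrite /inner linear0l. Qed.

Lemma innerDl (x y z : X) : inner dot (x + y) z = inner dot x z + inner dot y z.
Proof. by rewrite !(innerC _ z) innerDr rmorphD. Qed.

Lemma innerZl (a : R[i]) (x y : X) :
  inner dot (a *: x) y = Num.conj a * inner dot x y.
Proof. by rewrite innerC innerZr rmorphM [inner dot x y]innerC. Qed.

Lemma inner_sumr (I : Type) (r : seq I) (F : I -> X) (x : X) :
  inner dot x (\sum_(i <- r) F i) = \sum_(i <- r) inner dot x (F i).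
Proof.
by apply: (big_morph (inner dot x)) => [y z|]; rewrite ?innerDr ?inner0r.
Qed.

Hypothesis hX : hilbert_norm dot.

Lemma inner_self_gt0 (x : X) : x != 0 -> 0 < inner dot x x.
Proof. by rewrite -hX -normr_gt0 => /exprn_gt0; apply. Qed.

Lemma pythagoras (x y : X) :
  inner dot x y = 0 -> `|x + y| ^+ 2 = `|x| ^+ 2 + `|y| ^+ 2.
Proof.
move=> xy0; rewrite !hX innerDr !innerDl xy0 (innerC y x) xy0.
by rewrite rmorph0 addr0 add0r.
Qed.

(** [x] is the sum of its projection [a *: u], of norm [|a|], and an orthogonal rest, so Pythagoras
    applies. *)
Lemma norm_inner_unit (u x : X) : inner dot u u = 1 -> `|inner dot u x| <= `|x|.
Proof.
move=> u1; set a := inner dot u x.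
have normau : `|a *: u| ^+ 2 = `|a| ^+ 2.
  by rewrite normrZ exprMn hX u1 mulr1.
rewrite -ler_sqr ?nnegrE// -normau -[X in _ <= `|X| ^+ 2](subrK (a *: u)) addrC.
rewrite pythagoras ?lerDl ?exprn_ge0//.
by rewrite innerZl innerBr innerZr u1 mulr1 subrr mulr0.
Qed.

Lemma cauchy_schwarz (x y : X) : `|inner dot x y| <= `|x| * `|y|.
Proof.
have [->|x0] := eqVneq x 0; first by rewrite innerC inner0r rmorph0 !normr0 mul0r.
have nx0 : `|x| != 0 by rewrite normr_eq0.
have := @norm_inner_unit (`|x|^-1 *: x) y.
rewrite !innerZl innerZr -hX normrM norm_conjC normfV normr_id.
have -> : Num.conj `|x|^-1 = `|x|^-1 by apply/CrealP; rewrite rpredV normr_real.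
rewrite expr2 mulKf// mulVf// => /(_ erefl).
by rewrite ler_pdivrMl ?normr_gt0.
Qed.

Lemma cvg_inner (y l : X) (u : nat -> X) : u @ \oo --> l ->
  (fun n => inner dot y (u n) : R[i]^o) @ \oo --> (inner dot y l : R[i]^o).
Proof.
move=> ul; apply/cvgrPdist_lt => eps eps0.
(* Adding 1 keeps the divisor of [eps] positive even when [y] is 0. *)
have y1 : 0 < `|y| + 1 by rewrite ltr_wpDl.
have /cvgrPdist_lt/(_ (eps / (`|y| + 1))) := ul.
rewrite divr_gt0// => /(_ isT); apply: filterS => n.
rewrite ltr_pdivlMr// => hn; rewrite -innerBr.
apply: le_lt_trans (cauchy_schwarz _ _) (le_lt_trans _ hn).
by rewrite mulrC ler_wpM2l// lerDl.
Qed.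

Lemma norm_lim_le (l : X) (u : nat -> X) (B : R[i]) : u @ \oo --> l ->
  (forall n, `|u n| <= B) -> `|l| <= B.
Proof.
move=> ul uB; apply/ler_addgt0Pl => eps eps0.
have /cvgrPdist_lt/(_ _ eps0) [N _ /(_ N (leqnn N))/= hN] := ul.
by rewrite -[l](subrK (u N)) (le_trans (ler_normD _ _))// lerD// ltW.
Qed.

End InnerProduct.

(** * Expansions in a Hilbert basis *)

Section HilbertBasis.
Variables (R : realType) (X : completeNormedModType R[i]).
Variables (dot : {dot X for Num.conj}) (hX : hilbert_norm dot).
Variables (e : nat -> X) (he : hilbert_basis dot e).

Local Notation orthonormal := (proj1 he).

(** An arbitrary duplicate-free index list covers both partial sums and the blocks of the Cauchy
    criterion. *)
Lemma inner_basis_sum (a : nat -> R[i]) (r : seq nat) (k : nat) : uniq r ->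
  inner dot (e k) (\sum_(i <- r) a i *: e i) = if k \in r then a k else 0.
Proof.
move=> ur; rewrite inner_sumr.
under eq_bigr do rewrite innerZr orthonormal.
case: ifPn => kr.
  rewrite (bigD1_seq k)//= eqxx mulr1 big1 ?addr0// => i ik.
  by rewrite eq_sym (negPf ik) mulr0.
rewrite big_seq big1// => i ir.
by rewrite (_ : k == i = false) ?mulr0//; apply: contraNF kr => /eqP ->.
Qed.

Lemma norm_basis_sum (a : nat -> R[i]) (r : seq nat) : uniq r ->
  `|\sum_(i <- r) a i *: e i| ^+ 2 = \sum_(i <- r) `|a i| ^+ 2.
Proof.
move=> ur; rewrite hX inner_sumr big_seq [RHS]big_seq; apply: eq_bigr => i ir.
by rewrite innerZr innerC inner_basis_sum// ir normCK.
Qed.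

Lemma basis_remainder_orthogonal (x : X) (a : nat -> R[i]) (r : seq nat) :
  uniq r ->
  inner dot (x - \sum_(i <- r) inner dot (e i) x *: e i)
            (\sum_(i <- r) a i *: e i) = 0.
Proof.
move=> ur; rewrite inner_sumr big_seq big1// => i ir.
by rewrite innerZr innerC innerBr inner_basis_sum// ir subrr rmorph0 mulr0.
Qed.

Lemma bessel (x : X) (r : seq nat) : uniq r ->
  `|\sum_(i <- r) inner dot (e i) x *: e i| <= `|x|.
Proof.
move=> ur; rewrite -ler_sqr ?nnegrE//.
rewrite -[X in _ <= `|X| ^+ 2](subrK (\sum_(i <- r) inner dot (e i) x *: e i)).
by rewrite (pythagoras hX) ?basis_remainder_orthogonal// lerDr exprn_ge0.
Qed.

(** The right-hand vector is the remainder of [x] plus a combination of the [e i], which is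
    orthogonal to it. *)
Lemma best_approximation (x : X) (a : nat -> R[i]) (r : seq nat) : uniq r ->
  `|x - \sum_(i <- r) inner dot (e i) x *: e i| <=
  `|x - \sum_(i <- r) a i *: e i|.
Proof.
move=> ur; rewrite -ler_sqr ?nnegrE//.
set s := \sum_(i <- r) inner dot (e i) x *: e i.
rewrite -[x in leRHS](subrK s) -addrA.
have -> : s - \sum_(i <- r) a i *: e i =
    \sum_(i <- r) (inner dot (e i) x - a i) *: e i.
  by rewrite -sumrB; apply: eq_bigr => i _; rewrite scalerBl.
rewrite [leRHS](pythagoras hX) ?basis_remainder_orthogonal//.
by rewrite lerDl exprn_ge0.
Qed.

Lemma cvg_basis_expansion (x : X) :
  series (fun k => inner dot (e k) x *: e k) @ \oo --> x.
Proof.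
apply/cvgrPdist_lt => eps eps0.
(* Density speaks of nonempty open sets, hence the interior of the ball. *)
have xint : interior (ball x eps) x by exact: nbhsx_ballx.
have [y [/interior_subset xy [n [a yE]]]] :=
  proj2 he _ (ex_intro _ x xint) (@open_interior _ _).
move: xy; rewrite -ball_normE/= yE => xan; exists n => // m /= nm.
(* Padding a by zeros makes the approximant a competitor for every m >= n. *)
pose b k := if (k < n)%N then a k else 0.
apply: le_lt_trans (best_approximation x b (iota_uniq _ _)) _.
suff -> : \sum_(0 <= k < m) b k *: e k = \sum_(k < n) a k *: e k by [].
rewrite (big_cat_nat (leq0n n) nm)//= [X in _ + X]big_nat_cond.
rewrite [X in _ + X]big1 => [|k /andP[/andP[nk _] _]].
  by rewrite addr0 big_mkord; apply: eq_bigr => k _; rewrite /b ltn_ord.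
by rewrite /b ltnNge nk scale0r.
Qed.

(** Both vectors are limits of the same series. *)
Lemma eq_inner_basis (x y : X) :
  (forall k, inner dot (e k) x = inner dot (e k) y) -> x = y.
Proof.
move=> xy; have := @cvg_basis_expansion y.
rewrite -(_ : (fun k => inner dot (e k) x *: e k) =
             (fun k => inner dot (e k) y *: e k)).
  by move/(cvg_unique _ (@cvg_basis_expansion x)); apply.
by apply/funext => k; rewrite xy.
Qed.

(** * Diagonal operators; [convolution] and [functional_calculus] unfold to instances *)

Definition multiplier (m : nat -> R[i]) (x : X) : X :=
  limn (series (fun k => (m k * inner dot (e k) x) *: e k)).

Section Multiplier.
Variables (m : nat -> R[i]) (M : R[i]) (hm : forall k, `|m k| <= M).

Let M_ge0 : 0 <= M. Proof. exact: le_trans (hm 0). Qed.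

Lemma norm_multiplier_sum (x : X) (r : seq nat) : uniq r ->
  `|\sum_(i <- r) (m i * inner dot (e i) x) *: e i| <=
  M * `|\sum_(i <- r) inner dot (e i) x *: e i|.
Proof.
move=> ur; rewrite -ler_sqr ?nnegrE ?mulr_ge0// exprMn !norm_basis_sum//.
rewrite mulr_sumr; apply: ler_sum => i _.
by rewrite normrM exprMn ler_wpM2r ?exprn_ge0// ler_sqr ?nnegrE.
Qed.

Lemma cvg_multiplier (x : X) :
  series (fun k => (m k * inner dot (e k) x) *: e k) @ \oo --> multiplier m x.
Proof.
apply/cauchy_cvgP/cauchy_seriesP => eps eps0.
have M1 : 0 < M + 1 by rewrite ltr_wpDl.
have /cvgP/cauchy_cvgP/cauchy_seriesP/(_ (eps / (M + 1))) :=
  @cvg_basis_expansion x.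
rewrite divr_gt0// => /(_ isT); apply: filterS => n.
rewrite ltr_pdivlMr// => hn.
apply: le_lt_trans (norm_multiplier_sum _ (iota_uniq _ _)) (le_lt_trans _ hn).
by rewrite mulrC ler_wpM2l// lerDl.
Qed.

Lemma inner_basis_multiplier (x : X) (k : nat) :
  inner dot (e k) (multiplier m x) = m k * inner dot (e k) x.
Proof.
have := cvg_inner hX (y := e k) (@cvg_multiplier x).
have h : (fun n => inner dot (e k)
    (series (fun i => (m i * inner dot (e i) x) *: e i) n) : R[i]^o) @ \oo -->
    (m k * inner dot (e k) x : R[i]^o).
  (* The partial sum of index n stops before n, so it contains the k-th term from [k.+1] on, and its
     k-th coordinate is constant from there. *)
  apply: cvg_near_cst; exists k.+1 => // n /= kn.
  by rewrite inner_basis_sum ?iota_uniq// mem_index_iota kn.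
by move/cvg_unique => /(_ _ _ h); apply; exact: norm_hausdorff.
Qed.

Lemma norm_multiplier_le (x : X) : `|multiplier m x| <= M * `|x|.
Proof.
apply: norm_lim_le (@cvg_multiplier x) _ => n.
apply: le_trans (norm_multiplier_sum _ (iota_uniq _ _)) _.
by rewrite ler_wpM2l// bessel// iota_uniq.
Qed.

Lemma multiplier_linear : linear (multiplier m).
Proof.
move=> a x y; apply: eq_inner_basis => k.
by rewrite innerDr innerZr !inner_basis_multiplier innerDr innerZr mulrDr mulrCA.
Qed.

Lemma multiplier_bounded : bounded_operator (multiplier m).
Proof.
split; first exact: multiplier_linear.
(* [M] lies in [R[i]] but is nonnegative, hence equal to its real part. *)
exists (complex.Re M) => x.
by rewrite RRe_real ?ger0_real// norm_multiplier_le.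
Qed.

Lemma multiplier_basis (k : nat) : multiplier m (e k) = m k *: e k.
Proof.
apply: eq_inner_basis => l; rewrite inner_basis_multiplier innerZr orthonormal.
by have [->//|] := eqVneq l k; rewrite !mulr0.
Qed.

Lemma multiplier_symmetric (x y : X) : (forall k, m k \is Num.real) ->
  inner dot y (multiplier m x) = inner dot (multiplier m y) x.
Proof.
move=> mreal.
have := cvg_inner hX (y := multiplier m y) (@cvg_basis_expansion x).
have := cvg_inner hX (y := y) (@cvg_multiplier x).
(* The two sequences of partial sums agree term by term, since a real [m k] moves across the inner
   product; so their limits agree. *)
rewrite (_ : (fun n => _) = (fun n => inner dot (multiplier m y)
   (series (fun k => inner dot (e k) x *: e k) n)) :> (nat -> R[i]^o)).
  by move=> /cvg_unique h /h; apply; exact: norm_hausdorff.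
apply/funext => n; rewrite !inner_sumr; apply: eq_bigr => k _.
rewrite !innerZr ![inner dot _ (e k)]innerC inner_basis_multiplier rmorphM /=.
by have /CrealP -> := mreal k; rewrite mulrAC mulrA mulrC mulrA.
Qed.

Lemma multiplier_self_adjoint :
  self_adjoint dot [set: X] (multiplier m) <-> forall k, m k \is Num.real.
Proof.
split=> [sa k|mreal y z].
  (* Symmetry tested on the pair ([e k], [e k]) says that [m k] equals its conjugate. *)
  have /(_ (e k) I) := (proj2 (sa (e k) (multiplier m (e k))) (conj I erefl)).
  rewrite multiplier_basis innerZr innerZl orthonormal eqxx !mulr1.
  by move=> mk; apply/CrealP.
split=> [yz|[_ <-] x _]; last exact: multiplier_symmetric.
split=> //; apply: eq_inner_basis => k.
by rewrite innerC -multiplier_symmetric// yz// -innerC.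
Qed.

End Multiplier.

Lemma multiplierM (m m' : nat -> R[i]) (M M' : R[i]) (x : X) :
  (forall k, `|m k| <= M) -> (forall k, `|m' k| <= M') ->
  multiplier m (multiplier m' x) = multiplier (fun k => m k * m' k) x.
Proof.
move=> hm hm'; apply: eq_inner_basis => k.
rewrite !(inner_basis_multiplier hm) (inner_basis_multiplier hm').
rewrite (@inner_basis_multiplier _ (M * M')) ?mulrA// => l.
by rewrite normrM ler_pM.
Qed.

Lemma multiplier_positive (m : nat -> R[i]) (M : R[i]) :
  (forall k, `|m k| <= M) ->
  positive_operator dot (multiplier m) <-> forall k, 0 <= m k.
Proof.
move=> hm; split=> [pos k|m0 x].
  have := pos (e k).
  by rewrite (multiplier_basis hm) innerZr orthonormal eqxx mulr1.
(* T_m = T_s T_s with T_s symmetric, so <x | T_m x> = |T_s x|^2. *)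
have sm k : `|sqrtC (m k)| <= sqrtC M.
  rewrite ger0_norm ?sqrtC_ge0// ler_sqrtC ?nnegrE//.
    by rewrite -[m k]ger0_norm.
  exact: le_trans (hm 0).
rewrite (_ : multiplier m x =
             multiplier (sqrtC \o m) (multiplier (sqrtC \o m) x)).
  rewrite (multiplier_symmetric sm) -?hX ?exprn_ge0// => k.
  by rewrite ger0_real ?sqrtC_ge0.
rewrite (multiplierM _ sm sm); congr (multiplier _ x).
by apply/funext => k /=; rewrite -expr2 sqrtCK.
Qed.

Lemma norm_coord_le (x : X) (k : nat) : `|inner dot (e k) x| <= `|x|.
Proof. by apply: norm_inner_unit => //; rewrite orthonormal eqxx. Qed.

(** Reduces each claim about the operator to one about its diagonal entries, bounded because the
    coordinates of [C] are. *)
Lemma sub_convolutionE (c : R) (C : X) :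
  sub_convolution dot e c C = multiplier (fun k => c%:C - inner dot (e k) C).
Proof.
apply/funext => x; apply: eq_inner_basis => k.
rewrite /sub_convolution innerBr innerZr.
rewrite (inner_basis_multiplier (norm_coord_le C)).
rewrite (@inner_basis_multiplier _ (`|c%:C| + `|C|)) ?mulrBl// => l.
by rewrite (le_trans (ler_normB _ _))// lerD2l norm_coord_le.
Qed.

End HilbertBasis.

(** * The spectrum of [A] *)

Section Spectrum.
Variables (R : realType) (X : completeNormedModType R[i]).
Variables (dot : {dot X for Num.conj}) (D : set X) (A : X -> X).

(** A linear left inverse of A - z would send 0 to the eigenvector. *)
Lemma eigenvalue_in_spectrum (z : R[i]) :
  operator_eigenvalue D A z -> spectrum D A z.
Proof.
move=> [x [Dx /negP x0 Ax]] [B [[Blin _] _ /(_ x Dx)]].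
rewrite Ax subrr => B0; apply: x0; rewrite -B0.
by have := Blin (-1) 0 0; rewrite scaler0 addr0 scaleN1r addNr => ->.
Qed.

Hypothesis hsa : self_adjoint dot D A.

Lemma self_adjoint_symmetric (x y : X) : D x -> D y ->
  inner dot y (A x) = inner dot (A y) x.
Proof. by move=> Dx Dy; exact: (proj2 (hsa y (A y)) (conj Dy erefl)). Qed.

Hypothesis hX : hilbert_norm dot.

Lemma self_adjoint_eigenvalue_real (z : R[i]) :
  operator_eigenvalue D A z -> z \is Num.real.
Proof.
move=> [x [Dx x0 Ax]]; have := self_adjoint_symmetric Dx Dx.
rewrite Ax innerZr innerZl => /mulIf h; apply/CrealP/esym/h.
by rewrite gt_eqF// inner_self_gt0.
Qed.

Lemma spectrum_eigenbasis (e : nat -> X) (lambda : nat -> R[i]) :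
  purely_discrete_spectrum D A -> hilbert_basis dot e ->
  (forall k, eigenvector D A (lambda k) (e k)) ->
  spectrum D A = range lambda.
Proof.
move=> hdisc he hlambda; apply/seteqP; split=> [z|_ [k _ <-]]; last first.
  by apply: eigenvalue_in_spectrum; exists (e k).
move=> /hdisc[_ [x [Dx x0 Ax]] _]; apply: contrapT => zl.
move/eqP: x0; apply; apply: (eq_inner_basis hX he) => k.
have [Dk _ Ak] := hlambda k.
have /CrealP lreal : lambda k \is Num.real.
  by apply: self_adjoint_eigenvalue_real; exists (e k).
have /eqP := self_adjoint_symmetric Dx Dk.
(* Symmetry becomes (z - lambda k) <e_k|x> = 0, and [zl] excludes a zero first factor. *)
rewrite Ax Ak innerZr innerZl lreal -subr_eq0 -mulrBl mulf_eq0 inner0r.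
by case/orP=> /eqP// /subr0_eq zk; case: zl; exists k.
Qed.

End Spectrum.

Theorem theorem12 (R : realType) (X : completeNormedModType R[i])
    (dot : {dot X for Num.conj}) (hX : hilbert_norm dot)
    (hinf : ~ finite_dimensional [set: X])
    (D : set X) (A : X -> X)
    (hD : dense D) (hA : linear_operator D A) (hsa : self_adjoint dot D A)
    (hdisc : purely_discrete_spectrum D A)
    (e : nat -> X) (lambda : nat -> R[i])
    (he : hilbert_basis dot e)
    (hlambda : forall k, eigenvector D A (lambda k) (e k))
    (C : X) (c : R) :
  spectrum D A = range lambda /\
  [/\ bounded_operator (sub_convolution dot e c C),
      (self_adjoint dot [set: X] (sub_convolution dot e c C) <->
        forall k, inner dot (e k) C \is Num.real) /\
      (self_adjoint dot [set: X] (sub_convolution dot e c C) ->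
        (positive_operator dot (sub_convolution dot e c C) <->
          forall k, inner dot (e k) C <= c%:C)) &
      ((forall k l, lambda k = lambda l ->
          inner dot (e k) C = inner dot (e l) C) ->
        (exists f : R[i] -> R[i],
          forall k, f (lambda k) = inner dot (e k) C) /\
        (forall f : R[i] -> R[i],
          (forall k, f (lambda k) = inner dot (e k) C) ->
          (exists M : R, forall z, spectrum D A z -> `|f z| <= M%:C) /\
          sub_convolution dot e c C =
            functional_calculus dot e lambda (fun z => c%:C - f z)))].
Proof.
have specE := spectrum_eigenbasis hsa hX hdisc he hlambda.
have mB k : `|c%:C - inner dot (e k) C| <= `|c%:C| + `|C|.
  by rewrite (le_trans (ler_normB _ _))// lerD2l (norm_coord_le hX he).
split=> //; rewrite (sub_convolutionE hX he); split.
- exact: (multiplier_bounded hX he mB).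
- split.
    rewrite (multiplier_self_adjoint hX he mB).
    by split=> h k; have := h k; rewrite rpredBl ?complex_real.
  move=> _; rewrite (multiplier_positive hX he mB).
  by split=> h k; have := h k; rewrite subr_ge0.
- move=> hC; split.
    (* [xget] picks some index with eigenvalue z, and the default 0 off the range of [lambda]; by
       [hC] the value does not depend on the index picked. *)
    exists (fun z => inner dot (e (xget 0%N [set k | lambda k = z])) C) => k.
    by apply: hC; apply: (@xgetPex _ 0%N [set l | lambda l = lambda k]); exists k.
  move=> f fE; split.
    exists (complex.Re `|C|) => z; rewrite specE => -[k _ <-].
    by rewrite RRe_real ?normr_real// fE (norm_coord_le hX he).
  (* The functional calculus is the multiplier with entries c - f(lambda k), so only the entries
     remain to be compared. *)
  apply/funext => x; congr (multiplier dot e _ x).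
  by apply/funext => k; rewrite fE.
Qed.
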